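(* For integers $N\ge1$, $k\ge0$ and $m_1,\dots,m_N\ge0$ one has the recursion $$\mathtt C\big(k,N,(m_1,\dots,m_N)\big)=\sum_{\kappa=0}^{\min\{k,m_N\}}\ \sum_{(l_{\mathbf s})_{\mathbf s\ni N}:\ \sum_{\mathbf s\ni N} l_{\mathbf s}=\kappa}\ \ \sum_{(l^o_{\mathbf s})_{\mathbf s\ni N,\,|\mathbf s|\ge2}:\ \sum_{\mathbf s\ni N,\,|\mathbf s|\ge2} l^o_{\mathbf s}=m_N-\kappa}\mathtt C\big(k-\kappa,N-1,(\hat m_1(l,l^o),\dots,\hat m_{N-1}(l,l^o))\big),$$ where $\mathbf s$ ranges over subsets of $\{1,\dots,N\}$, the summation variables $l_{\mathbf s},l^o_{\mathbf s}$ are nonnegative integers, and for $r=1,\dots,N-1$ $$\hat m_r(l,l^o)=m_r-\sum_{\substack{\mathbf s\in\mathcal P(\{1,\dots,N-1\})\\ r\in\{N\}\cup\mathbf s}}\big(l_{\{N\}\cup\mathbf s}+l^o_{\{N\}\cup\mathbf s}\big).$$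
   Context: For $N\ge1$ let $\eta_N=2^N-1$ and let $\mathbf e_1,\dots,\mathbf e_{\eta_N}$ enumerate the nonempty subsets of $\{1,\dots,N\}$. For integers $m_1,\dots,m_N\ge0$, $D_N$ is the set of pairs $(l,l^o)$ of families of nonnegative integers $l=(l_{\mathbf e_n})_{1\le n\le\eta_N}$, $l^o=(l^o_{\mathbf e_n})_{1\le n\le\eta_N}$ such that $\sum_{n=1}^{\eta_N}(l_{\mathbf e_n}+l^o_{\mathbf e_n})\mathbf 1_{\mathbf e_n}(j)=m_j$ for all $j=1,\dots,N$; $|l|=\sum_n l_{\mathbf e_n}$. Define $$\mathtt C(k,N,(m_1,\dots,m_N)):=\big|\{(l,l^o)\in D_N:\ |l|=k,\ l^o_{\{1\}}=\dots=l^o_{\{N\}}=0\}\big|.$$ Conventions: $\mathtt C(k,N,(m_1,\dots,m_N)):=0$ if some $m_i<0$; for $N=0$ (empty tuple), $\mathtt C(0,0,())=1$ and $\mathtt C(k,0,())=0$ for $k\ne0$. A sum over the empty family (the case $N=1$ for $l^o$) has exactly one term if the required total is $0$ and none otherwise. $\mathcal P(A)$ denotes the power set of $A$. *)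

(* Defs.v *)
From HB Require Import structures.
From mathcomp Require Import all_boot all_order all_algebra.
From mathcomp Require Import finmap.
From mathcomp Require Import mathcomp_extra boolp classical_sets functions.
From mathcomp Require Import cardinality.

Set Implicit Arguments.
Unset Strict Implicit.
Unset Printing Implicit Defensive.

Import Order.TTheory GRing.Theory Num.Theory.

Local Open Scope classical_set_scope.
Local Open Scope nat_scope.

(** {1, ..., N} is encoded as 'I_N, the integer j being the ordinal of value
    j - 1; in 'I_n.+1 the last integer is thus [ord_max].

    A family of nonnegative integers indexed by a set [A] of subsets of
    {1, ..., N} is encoded by its extension by zero to all subsets, so that
    families indexed by [A] correspond one-to-one to elements of
    [families A].  In particular families are indexed by the subsets
    themselves, no enumeration e_1, ..., e_{eta_N} being chosen. *)
Definition families N (A : {set {set 'I_N}}) : set {ffun {set 'I_N} -> nat} :=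
  [set l | forall s, s \notin A -> l s = 0].

Definition nonempty_sets N : {set {set 'I_N}} :=
  [set s : {set 'I_N} | s != finset.set0]%SET.

Definition family_sum N (A : {set {set 'I_N}}) (l : {ffun {set 'I_N} -> nat}) :=
  \sum_(s in A) l s.

(** The m_j are allowed to be negative integers: D_N is then empty, which
    gives the convention C(k, N, m) = 0 (lemma [C_neg] below).  For N = 0 there
    is exactly one family, the empty one, so that C(k, 0, ()) is 1 if k = 0 and
    0 otherwise (lemma [C_0]). *)
Definition D N (m : 'I_N -> int) :
    set ({ffun {set 'I_N} -> nat} * {ffun {set 'I_N} -> nat}) :=
  [set p | [/\ families (nonempty_sets N) p.1,
               families (nonempty_sets N) p.2 &
               forall j : 'I_N,
                 Posz (\sum_(s in nonempty_sets N) (p.1 s + p.2 s) * (j \in s))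
                   = m j]].

Definition D_C (k N : nat) (m : 'I_N -> int) :
    set ({ffun {set 'I_N} -> nat} * {ffun {set 'I_N} -> nat}) :=
  [set p | [/\ D m p, family_sum (nonempty_sets N) p.1 = k &
               forall j : 'I_N, p.2 [set j]%SET = 0]].

(** [fset_set] has the junk value [fset0] on infinite sets; [finite_D_C] below
    shows that [D_C k m] is finite. *)
Definition C (k N : nat) (m : 'I_N -> int) : nat := #|` fset_set (D_C k m)|.

Definition sets_last n : {set {set 'I_n.+1}} :=
  [set s : {set 'I_n.+1} | ord_max \in s]%SET.

Definition sets_last2 n : {set {set 'I_n.+1}} :=
  [set s : {set 'I_n.+1} | (ord_max \in s) && (2 <= #|s|)]%SET.

Definition families_of_sum N (A : {set {set 'I_N}}) (q : nat) :
    set {ffun {set 'I_N} -> nat} :=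
  [set l | families A l /\ family_sum A l = q].

(** With N = n.+1, [powerset [set~ ord_max]] is the power set of
    {1, ..., N - 1}. *)
Definition used_last n (l lo : {ffun {set 'I_n.+1} -> nat}) (r : 'I_n) : nat :=
  \sum_(s in powerset [set~ ord_max]
        | (widen_ord (leqnSn n) r \in ord_max |: s)%SET)
     (l (ord_max |: s)%SET + lo (ord_max |: s)%SET).

Definition hat_m n (m : 'I_n.+1 -> nat) (l lo : {ffun {set 'I_n.+1} -> nat})
    (r : 'I_n) : int :=
  (Posz (m (widen_ord (leqnSn n) r)) - Posz (used_last l lo r))%R.

Lemma finite_bounded_ffun (T : finType) (b : nat) (A : set {ffun T -> nat}) :
  (forall f, A f -> forall x, f x <= b) -> finite_set A.
Proof.
move=> Ab; pose g (h : {ffun T -> 'I_b.+1}) := [ffun x => val (h x)].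
apply: (@sub_finite_set _ _ (g @` setT)); last first.
  exact/finite_image/finite_finset.
move=> f /Ab fb; exists [ffun x => inord (f x)] => //.
by apply/ffunP => x; rewrite !ffunE /= inordK // ltnS.
Qed.

Lemma families_of_sum_le N (A : {set {set 'I_N}}) q l s :
  families_of_sum A q l -> l s <= q.
Proof.
case=> lA <-; have [sA|/lA ->//] := boolP (s \in A).
by rewrite /family_sum (bigD1 s) //= leq_addr.
Qed.

Lemma finite_families_of_sum N (A : {set {set 'I_N}}) q :
  finite_set (families_of_sum A q).
Proof. by apply: (@finite_bounded_ffun _ q) => f fA s; exact: families_of_sum_le fA. Qed.

Lemma finite_D_C k N (m : 'I_N -> int) : finite_set (D_C k m).
Proof.
pose b := \sum_j `|m j|%N.
pose B := [set f : {ffun {set 'I_N} -> nat} | forall s, f s <= b].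
have fB : finite_set B by apply: (@finite_bounded_ffun _ b).
apply: (@sub_finite_set _ _ (B `*` B)); last exact: finite_setX.
move=> [l lo] [[/= l0 lo0 lm] _ _].
have bound s : s \in nonempty_sets N -> l s + lo s <= b.
  move=> sN; move: (sN); rewrite inE => /set0Pn[j js].
  rewrite /b (bigD1 j) //= -lm absz_nat (bigD1 s) //= js muln1.
  by rewrite -addnA leq_addr.
split=> s /=; have [sN|sN] := boolP (s \in nonempty_sets N).
- exact: leq_trans (leq_addr _ _) (bound _ sN).
- by rewrite l0.
- exact: leq_trans (leq_addl _ _) (bound _ sN).
- by rewrite lo0.
Qed.

Lemma C_neg k N (m : 'I_N -> int) (j : 'I_N) : (m j < 0)%R -> C k m = 0.
Proof.
move=> mj; rewrite /C (_ : D_C k m = set0) ?fset_set0 ?cardfs0 //.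
by apply/seteqP; split=> // p [[_ _ /(_ j) E] _ _]; move: mj; rewrite -E.
Qed.

Lemma C_0 k (m : 'I_0 -> int) : C k m = (k == 0).
Proof.
have ne0 : nonempty_sets 0 = finset.set0.
  by apply/setP => s; rewrite !inE; apply/negbTE/negPn/eqP/setP => -[].
have fam0 (l : {ffun {set 'I_0} -> nat}) :
    families (nonempty_sets 0) l -> l = [ffun=> 0].
  by rewrite ne0 => l0; apply/ffunP => s; rewrite ffunE l0 // inE.
rewrite /C; have [->|k0] := eqVneq k 0.
  rewrite (_ : D_C 0 m = [set ([ffun=> 0], [ffun=> 0])]).
    by rewrite fset_set1 cardfs1.
  apply/seteqP; split=> [[l lo] [[/= /fam0-> /fam0->]] //|_ ->].
  split; first split=> /=; rewrite /family_sum ?ne0 ?big_set0 //.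
  - by move=> s _; rewrite ffunE.
  - by move=> s _; rewrite ffunE.
  - by case.
  - by case.
rewrite (_ : D_C k m = set0) ?fset_set0 ?cardfs0 //.
apply/seteqP; split=> // p [_]; rewrite /family_sum ne0 big_set0 => E.
by rewrite -E eqxx in k0.
Qed.

(* Main.v *)
Require Import Defs.
From mathcomp Require Import all_boot all_order all_algebra.
From mathcomp Require Import finmap.
From mathcomp Require Import mathcomp_extra boolp classical_sets functions.
From mathcomp Require Import cardinality.

(** A pair of families counted by [C k m] on [n.+1] points splits in exactly one
    way into its values on the subsets containing the last point and its values
    on the other subsets, which are the images of the subsets of 'I_n.  The
    constraint at the last point only sees the first part: it says that the
    total of l and the total of lo there add up to [m ord_max].  Once the first
    part is chosen, with total kappa for l, every other constraint becomes a
    constraint on the second part, with k lowered to [k - kappa] and each m_r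
    lowered by what the first part uses at r, which gives [hat_m].  This is
    [D_C_split].  Among the singletons on which lo must vanish, only that of the
    last point belongs to the first part, which is why lo ranges there over
    families on [sets_last2].

    The recursion is then a count by fibers ([card_fibers]), first over kappa,
    then over the first part of l, then over the first part of lo; the last
    fibers are in bijection with the sets counted by [C (k - kappa)]
    ([card_D_C_fiber]). *)

Set Implicit Arguments.
Unset Strict Implicit.
Unset Printing Implicit Defensive.

Local Open Scope classical_set_scope.
Local Open Scope nat_scope.

(** * Counting by fibers *)

(** The values are listed in a sequence, so that the same count serves for sums
    over a range of integers and over an enumerated finite set. *)
Lemma card_fibers (T U : choiceType) (A : set T) (f : T -> U) (r : seq U) :
    finite_set A -> uniq r -> (forall x, A x -> f x \in r) ->
  #|` fset_set A| = \sum_(u <- r) #|` fset_set (A `&` [set x | f x = u])|.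
Proof.
move=> finA uniq_r fr.
rewrite -sum1_size (eq_big_seq (fun x => \sum_(u <- r) (f x == u))); last first.
  move=> x; rewrite in_fset_set // => /set_mem /fr fxr.
  rewrite (bigD1_seq (f x)) //= eqxx big1 ?addn0 // => u /negbTE.
  by rewrite eq_sym => ->.
rewrite exchange_big; apply: eq_bigr => u _ /=.
rewrite -big_mkcond sum1_count -size_filter; apply: perm_size.
apply: uniq_perm; rewrite ?filter_uniq ?fset_uniq // => x.
rewrite mem_filter !in_fset_set //; last exact: finite_setIl.
apply/andP/idP => [[/eqP fx /set_mem Ax]|/set_mem[Ax fx]].
  exact/mem_set.
by split; [exact/eqP | exact/mem_set].
Qed.

(** * Subsets with and without the last point *)

Definition emb n (s : {set 'I_n}) : {set 'I_n.+1} :=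
  [set widen_ord (leqnSn n) r | r in s]%SET.

Lemma widen_ord_neq_max n (r : 'I_n) : widen_ord (leqnSn n) r != ord_max.
Proof. by rewrite -val_eqE /= neq_ltn ltn_ord. Qed.

Lemma widen_ordS_inj n : injective (widen_ord (leqnSn n)).
Proof. by move=> r r' /(congr1 val) /= /val_inj. Qed.

Lemma mem_emb n (r : 'I_n) s : (widen_ord (leqnSn n) r \in emb s) = (r \in s).
Proof. exact/mem_imset/widen_ordS_inj. Qed.

Lemma max_notin_emb n (s : {set 'I_n}) : ord_max \notin emb s.
Proof.
by apply/imsetP => -[r _ /eqP]; rewrite eq_sym (negbTE (widen_ord_neq_max r)).
Qed.

Lemma ordS_cases n (P : 'I_n.+1 -> Prop) :
  P ord_max -> (forall r, P (widen_ord (leqnSn n) r)) -> forall j, P j.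
Proof.
move=> Pmax Pwiden j; have [->//|jmax] := eqVneq j ord_max.
have jn : j < n by rewrite ltn_neqAle -ltnS ltn_ord andbT.
by have -> : j = widen_ord (leqnSn n) (Ordinal jn) by exact: val_inj.
Qed.

Lemma embK n : cancel (@emb n) (fun s => widen_ord (leqnSn n) @^-1: s)%SET.
Proof. by move=> s; apply/setP => r; rewrite inE mem_emb. Qed.

Lemma emb_preim n (s : {set 'I_n.+1}) :
  ord_max \notin s -> emb (widen_ord (leqnSn n) @^-1: s)%SET = s.
Proof.
move=> sN; apply/setP; apply: ordS_cases => [|r].
  by rewrite (negbTE sN) (negbTE (max_notin_emb _)).
by rewrite mem_emb inE.
Qed.

Lemma emb0 n : emb (finset.set0 : {set 'I_n}) = finset.set0.
Proof. exact: imset0. Qed.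

Lemma emb_eq0 n (s : {set 'I_n}) : (emb s == finset.set0) = (s == finset.set0).
Proof. by rewrite -(inj_eq (can_inj (@embK n))) emb0. Qed.

Lemma emb1 n (r : 'I_n) : emb [set r]%SET = [set widen_ord (leqnSn n) r]%SET.
Proof. exact: imset_set1. Qed.

(** [emb] is a bijection onto the subsets that miss the last point, so a sum over
    subsets of 'I_n.+1 separates into the two kinds of subsets. *)
Lemma sum_sets_last n (P : pred {set 'I_n.+1}) F :
  \sum_(s | P s) F s =
    \sum_(s in sets_last n | P s) F s + \sum_(s | P (emb s)) F (emb s).
Proof.
rewrite (bigID (mem (sets_last n))) /=; congr (_ + _).
  by apply: eq_bigl => s; rewrite andbC.
rewrite (reindex_onto (@emb n) (fun s => widen_ord (leqnSn n) @^-1: s)%SET).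
  apply: eq_bigl => s; rewrite !inE max_notin_emb embK eqxx /=.
  by rewrite !andbT.
by move=> s /andP[_]; rewrite inE; exact: emb_preim.
Qed.

(** * Splitting a family *)

Definition fam n := {ffun {set 'I_n} -> nat}.

Definition restr n (l : fam n.+1) : fam n.+1 :=
  [ffun s : {set 'I_n.+1} => if ord_max \in s then l s else 0].

Definition pull n (l : fam n.+1) : fam n := [ffun s => l (emb s)].

Definition glue n (l : fam n.+1) (l' : fam n) : fam n.+1 :=
  [ffun s : {set 'I_n.+1} =>
    if ord_max \in s then l s else l' (widen_ord (leqnSn n) @^-1: s)%SET].

Lemma restr_pullK n (l : fam n.+1) : glue (restr l) (pull l) = l.
Proof.
apply/ffunP => s; rewrite !ffunE; case: ifPn => [->//|/emb_preim es].
by rewrite es.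
Qed.

Lemma restr_glue n (l : fam n.+1) l' :
  families (sets_last n) l -> restr (glue l l') = l.
Proof.
move=> lN; apply/ffunP => s; rewrite !ffunE; case: ifPn => [->//|sN].
by rewrite lN // inE.
Qed.

Lemma pull_glue n (l : fam n.+1) l' : pull (glue l l') = l'.
Proof.
by apply/ffunP => s; rewrite !ffunE (negbTE (max_notin_emb _)) embK.
Qed.

Lemma families_restr n (l : fam n.+1) : families (sets_last n) (restr l).
Proof. by move=> s; rewrite inE ffunE => /negbTE ->. Qed.

Lemma sub_families N (A B : {set {set 'I_N}}) l :
  A \subset B -> families A l -> families B l.
Proof.
by move=> AB lA s sB; apply: lA; apply: contra sB; exact: (fintype.subsetP AB).
Qed.

Lemma family_sum_sub N (A B : {set {set 'I_N}}) l :
  A \subset B -> families A l -> family_sum B l = family_sum A l.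
Proof.
move=> AB lA; rewrite /family_sum (big_setID A) /=.
rewrite (finset.setIidPr AB) [X in _ + X]big1 ?addn0 // => s.
by rewrite inE => /andP[/lA].
Qed.

Lemma sets_last2_sub n : sets_last2 n \subset sets_last n.
Proof. by apply/fintype.subsetP => s; rewrite !inE => /andP[]. Qed.

(** A subset containing the last point has at least two points unless it is the
    singleton of the last point, so this is the one value at stake. *)
Lemma families_last2 n (l : fam n.+1) :
  families (sets_last2 n) (restr l) <-> l [set ord_max]%SET = 0.
Proof.
split=> [/(_ [set ord_max]%SET)|lN s].
  by rewrite !inE eqxx cards1 ffunE inE eqxx; exact.
rewrite inE ffunE; case: ifP => //= sN; rewrite -ltnNge ltnS => s1.
rewrite -[RHS]lN; congr (l _); apply/esym/eqP.
by rewrite eqEcard finset.sub1set sN cards1.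
Qed.

(** Both sides only ask for the value 0 at the empty set, and [emb] preserves the
    empty set. *)
Lemma families_nonempty n (l : fam n.+1) :
  families (nonempty_sets n.+1) l <-> families (nonempty_sets n) (pull l).
Proof.
have famE N (f : fam N) : families (nonempty_sets N) f <-> f finset.set0 = 0.
  by split=> [|f0 s]; [apply; rewrite inE eqxx | rewrite inE negbK => /eqP->].
by rewrite !famE ffunE emb0.
Qed.

Lemma family_sum_nonempty n (l : fam n.+1) :
  family_sum (nonempty_sets n.+1) l =
    family_sum (sets_last n) (restr l) + family_sum (nonempty_sets n) (pull l).
Proof.
rewrite /family_sum sum_sets_last; congr (_ + _).
  apply: eq_big => s; rewrite !inE; last by case/andP => sN _; rewrite ffunE sN.
  by have [sN|//] := boolP (ord_max \in s); apply/set0Pn; exists ord_max.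
by apply: eq_big => s; rewrite ?inE ?emb_eq0 // ffunE.
Qed.

(** Adding and removing the last point matches the subsets of the other points
    with the subsets containing the last point. *)
Lemma used_lastE n (l lo : fam n.+1) (r : 'I_n) :
  used_last l lo r =
    \sum_(s in sets_last n) (l s + lo s) * (widen_ord (leqnSn n) r \in s).
Proof.
rewrite /used_last (reindex_onto (fun s => s :\ ord_max)%SET
                                 (fun s => ord_max |: s)%SET) /=.
  rewrite [RHS]big_mkcond /= big_mkcond; apply: eq_bigr => s _.
  have [sN|sN] := boolP (ord_max \in s); rewrite !inE; last first.
    rewrite (negbTE sN); case: ifP => // /andP[_ /eqP E].
    by move: sN; rewrite -E !inE eqxx.
  rewrite finset.setD1K // sN eqxx !andbT (negbTE (widen_ord_neq_max r)) /=.
  have -> : (s :\ ord_max \subset [set~ ord_max])%SET.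
    by apply/fintype.subsetP => j; rewrite !inE => /andP[].
  by rewrite /=; case: (_ \in s); rewrite ?muln1 ?muln0.
move=> s /andP[]; rewrite inE => /fintype.subsetP sN _; rewrite finset.setU1K //.
by apply/negP => /sN; rewrite !inE eqxx.
Qed.

Lemma restrE n (l : fam n.+1) s : s \in sets_last n -> restr l s = l s.
Proof. by rewrite inE ffunE => ->. Qed.

Lemma degree_nonempty N (l lo : fam N) (j : 'I_N) :
  \sum_(s in nonempty_sets N) (l s + lo s) * (j \in s) =
  \sum_s (l s + lo s) * (j \in s).
Proof.
rewrite [LHS]big_mkcond; apply: eq_bigr => s _; rewrite inE.
by case: eqVneq => // ->; rewrite inE muln0.
Qed.

Lemma degree_max n (l lo : fam n.+1) :
  \sum_(s in nonempty_sets n.+1) (l s + lo s) * (ord_max \in s) =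
  family_sum (sets_last n) (restr l) + family_sum (sets_last n) (restr lo).
Proof.
rewrite degree_nonempty sum_sets_last [X in _ + X]big1 => [|s _]; last first.
  by rewrite (negbTE (max_notin_emb _)) muln0.
rewrite addn0 -big_split; apply: eq_big => s; first by rewrite andbT.
rewrite andbT => sN; rewrite /= !restrE //.
by move: sN; rewrite inE => ->; rewrite muln1.
Qed.

Lemma degree_widen n (l lo : fam n.+1) (r : 'I_n) :
  \sum_(s in nonempty_sets n.+1)
     (l s + lo s) * (widen_ord (leqnSn n) r \in s) =
  used_last (restr l) (restr lo) r +
  \sum_(s in nonempty_sets n) (pull l s + pull lo s) * (r \in s).
Proof.
rewrite !degree_nonempty sum_sets_last used_lastE; congr (_ + _).
  by apply: eq_big => s; rewrite andbT // => sN; rewrite !restrE.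
by apply: eq_bigr => s _; rewrite mem_emb !ffunE.
Qed.

(** The conditions defining [D_C] separate along the splitting: the constraint
    at the last point and the singleton of the last point concern the restricted
    families only, and the remaining ones are conditions on the pulled back
    families once the share of the restricted ones is subtracted.  The bound
    [kappa <= k] is there because [k - kappa] is truncated, whereas [hat_m] takes
    its differences in the integers. *)
Lemma D_C_split n k (m : 'I_n.+1 -> nat) (p : fam n.+1 * fam n.+1) :
  let kappa := family_sum (sets_last n) (restr p.1) in
  D_C k (fun j => Posz (m j)) p <->
  [/\ kappa <= k,
      kappa + family_sum (sets_last n) (restr p.2) = m ord_max,
      families (sets_last2 n) (restr p.2) &
      D_C (k - kappa) (hat_m m (restr p.1) (restr p.2)) (pull p.1, pull p.2)].
Proof.
case: p => l lo /=; set kappa := family_sum _ _; split.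
  case=> -[/= l0 lo0 lm] lk lo1; split.
  - by rewrite -lk family_sum_nonempty leq_addr.
  - by have [<-] := lm ord_max; rewrite degree_max.
  - exact/families_last2.
  - split=> /=; [split=> /=| |].
    + exact/families_nonempty.
    + exact/families_nonempty.
    + move=> r; have [] := lm (widen_ord (leqnSn n) r).
      by rewrite degree_widen /hat_m => <-; rewrite PoszD GRing.addrC GRing.addKr.
    + by rewrite -lk family_sum_nonempty addKn.
    + by move=> r; rewrite ffunE emb1.
case=> le_k lm /families_last2 loN [[/= l0 lo0 lr] lk lo1].
split=> /=; [split=> /=| |].
- exact/families_nonempty.
- exact/families_nonempty.
- apply: ordS_cases => [|r]; first by rewrite degree_max lm.
  by rewrite degree_widen PoszD lr /hat_m GRing.addrC GRing.subrK.
- by rewrite family_sum_nonempty lk subnKC.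
- by apply: ordS_cases => [//|r]; have := lo1 r; rewrite ffunE emb1.
Qed.

(** * The recursion *)

(** Once both restrictions are prescribed, a pair is determined by its pull back,
    and gluing is the inverse bijection; by [D_C_split] it matches the fiber with
    the families counted in one dimension less. *)
Lemma card_D_C_fiber n k (m : 'I_n.+1 -> nat) kappa (l lo : fam n.+1) :
    kappa <= k -> kappa <= m ord_max ->
    families_of_sum (sets_last n) kappa l ->
    families_of_sum (sets_last2 n) (m ord_max - kappa) lo ->
  #|` fset_set (D_C k (fun j => Posz (m j)) `&`
                [set p | restr p.1 = l] `&` [set p | restr p.2 = lo])| =
  C (k - kappa) (hat_m m l lo).
Proof.
move=> le_k le_m [lN sl] [lo2 slo].
have loN := sub_families (sets_last2_sub n) lo2.
pose g (q : fam n * fam n) := (glue l q.1, glue lo q.2).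
have -> : D_C k (fun j => Posz (m j)) `&`
    [set p | restr p.1 = l] `&` [set p | restr p.2 = lo] =
    g @` D_C (k - kappa) (hat_m m l lo).
  apply/seteqP; split=> [[a b] [[/D_C_split[/= _ _ _ abD] al] blo]|].
    exists (pull a, pull b); last by rewrite /g /= -al -blo !restr_pullK.
    by move: al blo abD => /= -> ->; rewrite sl.
  move=> _ [[a b] abD <-]; rewrite /g /=; split; last exact: restr_glue.
  split; last exact: restr_glue.
  apply/D_C_split; rewrite /= !restr_glue // !pull_glue sl.
  by split=> //; rewrite (family_sum_sub (sets_last2_sub n)) // slo subnKC.
rewrite /C fset_set_image ?card_imfset //; last exact: finite_D_C.
move=> [a b] [a' b'] [/(congr1 (@pull n)) + /(congr1 (@pull n))].
by rewrite !pull_glue => -> ->.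
Qed.

Theorem proposition6p1 (n k : nat) (m : 'I_n.+1 -> nat) :
  C k (fun j => Posz (m j)) =
  \sum_(0 <= kappa < (minn k (m ord_max)).+1)
    \sum_(l <- fset_set (families_of_sum (sets_last n) kappa))
      \sum_(lo <- fset_set
                    (families_of_sum (sets_last2 n) (m ord_max - kappa)))
        C (k - kappa) (hat_m m l lo).
Proof.
set K := D_C k (fun j => Posz (m j)).
have finK : finite_set K by exact: finite_D_C.
rewrite /C (card_fibers (f := fun p => family_sum (sets_last n) (restr p.1))
                        finK (iota_uniq 0 (minn k (m ord_max)).+1)); last first.
  move=> p /D_C_split[le_k sm _ _].
  by rewrite mem_iota /= add0n ltnS leq_min le_k -sm leq_addr.
rewrite /index_iota subn0.
apply: eq_big_seq => kappa.
rewrite mem_iota ltnS leq_min => /andP[_ /andP[le_k le_m]].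
set Kk := K `&` _.
have finKk : finite_set Kk by exact: finite_setIl.
rewrite (card_fibers (f := fun p => restr p.1) finKk
  (fset_uniq (fset_set (families_of_sum (sets_last n) kappa)))); last first.
  move=> p [_ pk]; rewrite in_fset_set; last exact: finite_families_of_sum.
  by apply/mem_set; split; first exact: families_restr.
apply: eq_big_seq => l; rewrite in_fset_set; last exact: finite_families_of_sum.
move=> /set_mem lk; set Kl := Kk `&` _.
have finKl : finite_set Kl by exact: finite_setIl.
rewrite (card_fibers (f := fun p => restr p.2) finKl
  (fset_uniq (fset_set (families_of_sum (sets_last2 n) (m ord_max - kappa)))));
  last first.
  move=> p [[/D_C_split[_ sm lo2 _] /= pk] _].
  rewrite in_fset_set; last exact: finite_families_of_sum.
  apply/mem_set; split=> //.
  by rewrite -(family_sum_sub (sets_last2_sub n) lo2) -sm pk addKn.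
apply: eq_big_seq => lo; rewrite in_fset_set; last exact: finite_families_of_sum.
move=> /set_mem lok; rewrite -[RHS](card_D_C_fiber le_k le_m lk lok).
congr (#|` fset_set (_ `&` _)|); rewrite /Kl /Kk -setIA; congr (_ `&` _).
(* The condition on kappa follows from the choice of l. *)
by apply/seteqP; split=> p [] //= pl; split=> //; rewrite pl; case: lk.
Qed.
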